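(* Let $X$ be a normed lattice and $(E_n)_{n\ge1}$ a contractive filtration on $X$, and let $M_E=M_E(X,(E_n))$ be the space of all bounded $\mathcal{E}$-martingales with respect to $(E_n)$, equipped with the coordinate-wise order. Then the following statements are equivalent: (i) $M_E$ is a vector lattice. (ii) For each $A=(x_n)$ in $M_E$, the sequence $(|x_n|)$ is an $\mathcal{E}$-martingale and $|A|=(|x_n|)$ (that is, the modulus of $A$ in the ordered vector space $M_E$ exists and equals $(|x_n|)$). (iii) $M_E$ is a sublattice of $\ell_\infty(X)$.
   Context: A contractive filtration on a normed lattice $X$ is a sequence $(E_n)_{n\ge1}$ of positive linear projections on $X$ (i.e. $E_n^2=E_n$ and $E_nx\ge0$ whenever $x\ge0$) which are contractive ($\|E_nx\|\le\|x\|$ for all $x\in X$) and satisfy $E_nE_m=E_{\min(n,m)}$ for all $n,m$. A sequence $(x_n)_{n\ge1}$ in $X$ is an $\mathcal{E}$-martingale with respect to $(E_n)$ if there exists $l\ge1$ such that $E_nx_m=x_n$ whenever $m\ge n\ge l$ (equivalently, there is $l\geq 1$ with $E_mx_{m+1}=x_m$ for all $m\ge l$). A sequence $A=(x_n)$ is bounded if $\|A\|:=\sup_n\|x_n\|<\infty$. The coordinate-wise order is: $(x_n)\ge(y_n)$ iff $x_n\ge y_n$ for every $n$; with this order $M_E$ is an ordered vector space, and ''vector lattice'' refers to this order. $\ell_\infty(X)$ denotes the space of all bounded sequences in $X$, a vector lattice under coordinate-wise order and lattice operations. *)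

(* Defs.v *)
From HB Require Import structures.
From mathcomp Require Import all_boot all_order all_algebra.
From mathcomp Require Import all_classical all_reals all_analysis.
Import Order.TTheory GRing.Theory Num.Theory.
Import numFieldNormedType.Exports.

Set Implicit Arguments.
Unset Strict Implicit.
Unset Printing Implicit Defensive.

Local Open Scope classical_set_scope.
Local Open Scope ring_scope.

HB.mixin Record isOrderedLmodule (R : numDomainType) V
    & GRing.Lmodule R V & Order.POrder ring_display V := {
  lev_wD2r : forall z x y : V, x <= y -> x + z <= y + z;
  scalev_ge0 : forall (a : R) (x : V), 0 <= a -> 0 <= x -> 0 <= a *: x
}.

#[short(type="orderedLmodType")]
HB.structure Definition OrderedLmodule (R : numDomainType) :=
  { V of GRing.Lmodule R V & Order.POrder ring_display V
       & isOrderedLmodule R V }.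

(* The lattice operations below and the norm of a normed lattice are not those
   of Order.Lattice and NormedModule: HB rejects a structure joining
   Order.Lattice with GRing.Lmodule, or Order.POrder with NormedModule, because
   Num.RealDomain, resp. Num.NumDomain, would have to inherit from it. *)
HB.mixin Record OrderedLmodule_isVectorLattice (R : numDomainType) V
    & OrderedLmodule R V := {
  vjoin : V -> V -> V;
  vmeet : V -> V -> V;
  vjoin_le : forall x y z : V, (vjoin x y <= z) = (x <= z) && (y <= z);
  le_vmeet : forall x y z : V, (x <= vmeet y z) = (x <= y) && (x <= z)
}.

#[short(type="vectorLatticeType")]
HB.structure Definition VectorLattice (R : numDomainType) :=
  { V of OrderedLmodule R V & OrderedLmodule_isVectorLattice R V }.

Definition modulus (R : numDomainType) (V : vectorLatticeType R) (x : V) : V :=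
  vjoin x (- x).

HB.mixin Record VectorLattice_isNormedLattice (R : numDomainType) V
    & VectorLattice R V := {
  lnorm : V -> R;
  lnorm0_eq0 : forall x : V, lnorm x = 0 -> x = 0;
  lnormZ : forall (a : R) (x : V), lnorm (a *: x) = `|a| * lnorm x;
  ler_lnormD : forall x y : V, lnorm (x + y) <= lnorm x + lnorm y;
  ler_lnorm_modulus :
    forall x y : V, modulus x <= modulus y -> lnorm x <= lnorm y
}.

#[short(type="normedLatticeType")]
HB.structure Definition NormedLattice (R : numDomainType) :=
  { V of VectorLattice R V & VectorLattice_isNormedLattice R V }.

(* For an ordered vector space whose order is not known to be a lattice. *)
Definition is_vector_lattice (R : numDomainType) (V : orderedLmodType R) :=
  forall x y : V,
    supremums [set x; y] !=set0 /\ infimums [set x; y] !=set0.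

(* Being a modulus in V is relative to V: the least element of V dominating
   both x and -x. *)
Definition is_modulus (R : numDomainType) (V : orderedLmodType R) (x m : V) :=
  supremums [set x; - x] m.

Definition is_sublattice (R : numDomainType) (V : vectorLatticeType R)
    (S : {pred V}) :=
  submod_closed S /\
  {in S &, forall x y : V, vjoin x y \in S /\ vmeet x y \in S}.

Section OrderedLmoduleTheory.
Variables (R : numDomainType) (V : orderedLmodType R).
Implicit Types x y z t : V.

Lemma lev_D x y z t : x <= y -> z <= t -> x + z <= y + t.
Proof.
move=> xy zt; apply: le_trans (lev_wD2r z _ _ xy) _.
by rewrite !(addrC y); apply: lev_wD2r.
Qed.

Lemma lev_N x y : x <= y -> - y <= - x.
Proof.
move=> /(lev_wD2r (- x - y)).
by rewrite addrA subrr sub0r (addrC (- x)) addrA subrr sub0r.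
Qed.

Lemma lev_Nl x y : - x <= y -> - y <= x.
Proof. by move=> /lev_N; rewrite opprK. Qed.

End OrderedLmoduleTheory.

Section VectorLatticeTheory.
Variables (R : numFieldType) (V : vectorLatticeType R).
Implicit Types x y : V.

Lemma le_vjoinl x y : x <= vjoin x y.
Proof. by have := lexx (vjoin x y); rewrite vjoin_le => /andP[]. Qed.

Lemma le_vjoinr x y : y <= vjoin x y.
Proof. by have := lexx (vjoin x y); rewrite vjoin_le => /andP[]. Qed.

Lemma vmeet_lel x y : vmeet x y <= x.
Proof. by have := lexx (vmeet x y); rewrite le_vmeet => /andP[]. Qed.

Lemma le_modulus x : x <= modulus x. Proof. exact: le_vjoinl. Qed.

Lemma leN_modulus x : - x <= modulus x. Proof. exact: le_vjoinr. Qed.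

Lemma modulus_le x y : x <= y -> - x <= y -> modulus x <= y.
Proof. by move=> h1 h2; rewrite vjoin_le h1 h2. Qed.

Lemma modulus_ge0 x : 0 <= modulus x.
Proof.
have h : 0 <= modulus x + modulus x.
  by rewrite -(subrr x) lev_D ?le_modulus ?leN_modulus.
have -> : modulus x = (2^-1 : R) *: (modulus x + modulus x).
  by rewrite -[X in X + X]scale1r -scalerDl scalerA mulVf ?scale1r ?pnatr_eq0.
by apply: scalev_ge0 h; rewrite invr_ge0 ler0n.
Qed.

Lemma modulus_id x : modulus (modulus x) = modulus x.
Proof.
apply/le_anti; rewrite le_modulus andbT modulus_le//.
by apply: le_trans (modulus_ge0 x); rewrite -oppr0 lev_N ?modulus_ge0.
Qed.

End VectorLatticeTheory.

Section NormedLatticeTheory.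
Variables (R : numFieldType) (X : normedLatticeType R).
Implicit Types x y z : X.

Lemma lnorm_modulus x : lnorm (modulus x) = lnorm x.
Proof. by apply/le_anti; rewrite !ler_lnorm_modulus ?modulus_id. Qed.

Lemma lnorm_le_sum x y z : modulus z <= modulus x + modulus y ->
  lnorm z <= lnorm x + lnorm y.
Proof.
move=> h; rewrite -(lnorm_modulus x) -(lnorm_modulus y).
apply: le_trans (ler_lnormD _ _); apply: ler_lnorm_modulus.
exact: le_trans h (le_modulus _).
Qed.

Lemma le_modulusl x y z : z <= modulus x -> z <= modulus x + modulus y.
Proof.
by move=> zx; rewrite -(addr0 z); apply: lev_D zx (modulus_ge0 _).
Qed.

Lemma le_modulusr x y z : z <= modulus y -> z <= modulus x + modulus y.
Proof. by rewrite addrC; exact: le_modulusl. Qed.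

Lemma lnorm_vjoin x y : lnorm (vjoin x y) <= lnorm x + lnorm y.
Proof.
apply/lnorm_le_sum/modulus_le.
  by rewrite vjoin_le le_modulusl ?le_modulusr ?le_modulus.
apply: le_modulusl; apply: le_trans (leN_modulus x).
exact/lev_N/le_vjoinl.
Qed.

Lemma lnorm_vmeet x y : lnorm (vmeet x y) <= lnorm x + lnorm y.
Proof.
apply/lnorm_le_sum/modulus_le.
  exact/le_modulusl/(le_trans (vmeet_lel x y))/le_modulus.
apply: lev_Nl; rewrite le_vmeet.
apply/andP; split; apply: lev_Nl.
  exact/le_modulusl/leN_modulus.
exact/le_modulusr/leN_modulus.
Qed.

End NormedLatticeTheory.

Section linf.
Variables (R : realType) (X : normedLatticeType R).
Implicit Types u v : nat -> X.

Definition bounded_seq u := exists M : R, forall n, lnorm (u n) <= M.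

Definition linf_pred : {pred nat -> X} := mem [set u | bounded_seq u].

Lemma linf_predP u : reflect (bounded_seq u) (u \in linf_pred).
Proof. by apply: (iffP idP) => [/set_mem|/mem_set]. Qed.

Lemma linf_submod_closed : submod_closed linf_pred.
Proof.
split.
  by apply/linf_predP; exists 0 => n; rewrite -(scale0r 0) lnormZ normr0 mul0r.
move=> a u v /linf_predP[M uM] /linf_predP[N vN]; apply/linf_predP.
exists (`|a| * M + N) => n; apply: le_trans (ler_lnormD _ _) _.
by rewrite lerD// lnormZ ler_wpM2l.
Qed.

HB.instance Definition _ :=
  GRing.isSubmodClosed.Build R (nat -> X) linf_pred linf_submod_closed.

Record linf := Linf { linf_val : nat -> X; _ : linf_val \in linf_pred }.

HB.instance Definition _ := [isSub for linf_val].
HB.instance Definition _ := [Choice of linf by <:].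
HB.instance Definition _ := [SubChoice_isSubLmodule of linf by <:].

Definition linf_fun (A : linf) (n : nat) : X := val A n.
Coercion linf_fun : linf >-> Funclass.

Implicit Types A B C : linf.

Lemma linfP A B : (forall n, A n = B n) -> A = B.
Proof. by move=> AB; apply/val_inj/funext. Qed.

Lemma linfD A B n : (A + B) n = A n + B n. Proof. by []. Qed.

Lemma linfN A n : (- A) n = - A n. Proof. by []. Qed.

Lemma linfZ (a : R) A n : (a *: A) n = a *: A n. Proof. by []. Qed.

Lemma linf0 n : (0 : linf) n = 0. Proof. by []. Qed.

Definition le_linf A B := `[< forall n, A n <= B n >].

Fact le_linf_refl : reflexive le_linf.
Proof. by move=> A; apply/asboolP. Qed.

Fact le_linf_anti : antisymmetric le_linf.
Proof.
move=> A B /andP[/asboolP AB /asboolP BA]; apply: linfP => n.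
by apply/le_anti; rewrite AB BA.
Qed.

Fact le_linf_trans : transitive le_linf.
Proof.
move=> B A C /asboolP AB /asboolP BC; apply/asboolP => n.
exact: le_trans (AB n) (BC n).
Qed.

HB.instance Definition _ := Order.Le_isPOrder.Build ring_display linf
  le_linf_refl le_linf_anti le_linf_trans.

Lemma le_linfP A B : reflect (forall n, A n <= B n) (A <= B).
Proof. exact: asboolP. Qed.

Fact linf_join_subproof A B :
  (fun n => vjoin (A n) (B n)) \in linf_pred.
Proof.
have /linf_predP[M AM] := valP A; have /linf_predP[N BN] := valP B.
apply/linf_predP; exists (M + N) => n.
by apply: le_trans (lnorm_vjoin _ _) _; rewrite lerD// ?AM ?BN.
Qed.

Fact linf_meet_subproof A B :
  (fun n => vmeet (A n) (B n)) \in linf_pred.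
Proof.
have /linf_predP[M AM] := valP A; have /linf_predP[N BN] := valP B.
apply/linf_predP; exists (M + N) => n.
by apply: le_trans (lnorm_vmeet _ _) _; rewrite lerD// ?AM ?BN.
Qed.

Definition linf_join A B := Linf (linf_join_subproof A B).
Definition linf_meet A B := Linf (linf_meet_subproof A B).

Fact linf_meetP A B C : (A <= linf_meet B C) = (A <= B) && (A <= C).
Proof.
apply/le_linfP/andP => [h|[/le_linfP AB /le_linfP AC] n].
  by split; apply/le_linfP => n; have := h n; rewrite le_vmeet => /andP[].
by rewrite le_vmeet AB AC.
Qed.

Fact linf_joinP A B C : (linf_join A B <= C) = (A <= C) && (B <= C).
Proof.
apply/le_linfP/andP => [h|[/le_linfP AC /le_linfP BC] n].
  by split; apply/le_linfP => n; have := h n; rewrite vjoin_le => /andP[].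
by rewrite vjoin_le AC BC.
Qed.

Fact linf_lev_wD2r C A B : A <= B -> A + C <= B + C.
Proof.
move=> /le_linfP AB; apply/le_linfP => n.
by rewrite !linfD lev_wD2r.
Qed.

Fact linf_scalev_ge0 (a : R) A : 0 <= a -> 0 <= A -> 0 <= a *: A.
Proof.
move=> a0 /le_linfP A0; apply/le_linfP => n.
exact: scalev_ge0 a0 (A0 n).
Qed.

HB.instance Definition _ :=
  isOrderedLmodule.Build R linf linf_lev_wD2r linf_scalev_ge0.

HB.instance Definition _ := OrderedLmodule_isVectorLattice.Build R linf
  linf_joinP linf_meetP.

End linf.

(* Filtrations and sequences are indexed from 0 rather than from 1. *)
Record contractive_filtration (R : realType) (X : normedLatticeType R)
    (E : nat -> {linear X -> X}) : Prop := ContractiveFiltration {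
  cfilt_proj : forall n x, E n (E n x) = E n x;
  cfilt_ge0 : forall n x, 0 <= x -> 0 <= E n x;
  cfilt_contr : forall n x, lnorm (E n x) <= lnorm x;
  cfilt_min : forall n m x, E n (E m x) = E (minn n m) x
}.

Definition E_martingale (R : realType) (X : normedLatticeType R)
    (E : nat -> {linear X -> X}) (x : nat -> X) :=
  exists l : nat, forall n m : nat, (l <= n)%N -> (n <= m)%N -> E n (x m) = x n.

Section bounded_E_martingales.
Variables (R : realType) (X : normedLatticeType R) (E : nat -> {linear X -> X}).

Definition ME_pred : {pred linf X} := mem [set A : linf X | E_martingale E A].

Lemma ME_predP (A : linf X) : reflect (E_martingale E A) (A \in ME_pred).
Proof. by apply: (iffP idP) => [/set_mem|/mem_set]. Qed.

Lemma ME_submod_closed : submod_closed ME_pred.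
Proof.
split; first by apply/ME_predP; exists 0%N => n m _ _; rewrite linf0 linear0.
move=> a A B /ME_predP[k Ak] /ME_predP[l Bl]; apply/ME_predP.
exists (maxn k l) => n m; rewrite geq_max => /andP[kn ln] nm.
by rewrite !linfD !linfZ linearP/= Ak// Bl.
Qed.

HB.instance Definition _ :=
  GRing.isSubmodClosed.Build R (linf X) ME_pred ME_submod_closed.

Record ME := MEmk { ME_val :> linf X; _ : ME_val \in ME_pred }.

HB.instance Definition _ := [isSub for ME_val].
HB.instance Definition _ := [Choice of ME by <:].
HB.instance Definition _ := [SubChoice_isSubLmodule of ME by <:].
HB.instance Definition _ := [SubChoice_isSubPOrder of ME by <: with ring_display].

Lemma le_MEP (A B : ME) : reflect (forall n, A n <= B n) (A <= B).
Proof. exact: le_linfP. Qed.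

Fact ME_lev_wD2r (C A B : ME) : A <= B -> A + C <= B + C.
Proof. exact: linf_lev_wD2r. Qed.

Fact ME_scalev_ge0 (a : R) (A : ME) : 0 <= a -> 0 <= A -> 0 <= a *: A.
Proof. exact: linf_scalev_ge0. Qed.

HB.instance Definition _ :=
  isOrderedLmodule.Build R ME ME_lev_wD2r ME_scalev_ge0.

End bounded_E_martingales.

(* Main.v *)
(** The only substantial implication is (i) => (ii). Let B be the modulus of A
    in the ordered space M_E, so that B_n >= |A_n| for all n. Being an
    E-martingale depends only on the tail of a sequence, so replacing the single
    term B_k by |A_k| yields another element of M_E dominating A and -A; hence
    B_k <= |A_k| by minimality of B. *)

Require Import Defs.
From HB Require Import structures.
From mathcomp Require Import all_boot all_order all_algebra.
From mathcomp Require Import all_classical all_reals all_analysis.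
Import Order.TTheory GRing.Theory Num.Theory.
Import numFieldNormedType.Exports.

Set Implicit Arguments.
Unset Strict Implicit.
Unset Printing Implicit Defensive.

Local Open Scope classical_set_scope.
Local Open Scope ring_scope.

Section VectorLattice.
Variables (R : numFieldType) (V : vectorLatticeType R).
Implicit Types x y z : V.

Lemma lev_subr_addr x y z : (x <= y - z) = (x + z <= y).
Proof.
apply/idP/idP => [/(lev_wD2r z)|/(lev_wD2r (- z))]; first by rewrite subrK.
by rewrite addrK.
Qed.

Lemma lev_wpZ2l (a : R) x y : 0 <= a -> x <= y -> a *: x <= a *: y.
Proof.
move=> a0 xy; have : 0 <= a *: (y - x).
  by apply: scalev_ge0 => //; rewrite lev_subr_addr add0r.
by rewrite scalerBr lev_subr_addr add0r.
Qed.

Lemma scale_halfD x : (2^-1 : R) *: (x + x) = x.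
Proof.
by rewrite -[X in X + X]scale1r -scalerDl scalerA mulVf ?scale1r ?pnatr_eq0.
Qed.

(** Adding [x - y] or its opposite to [x + y] gives [x + x] or [y + y], so the right side dominates
    [x] and [y]. Conversely, twice the join minus [x + y] dominates both [x - y] and its opposite,
    hence their modulus. *)
Lemma vjoin_modulus x y : vjoin x y = (2^-1 : R) *: (x + y + modulus (x - y)).
Proof.
have half_le (u v : V) : u <= v -> (2^-1 : R) *: u <= (2^-1 : R) *: v.
  by apply: lev_wpZ2l; rewrite invr_ge0 ler0n.
have xE : x + y + (x - y) = x + x by rewrite addrACA subrr addr0.
have yE : x + y - (x - y) = y + y.
  by rewrite opprB (addrC y) addrACA subrr add0r.
apply/le_anti/andP; split.
  rewrite vjoin_le; apply/andP; split.
    by rewrite -[leLHS]scale_halfD -xE half_le// lev_D// le_modulus.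
  by rewrite -[leLHS]scale_halfD -yE half_le// lev_D// leN_modulus.
rewrite -[leRHS]scale_halfD; apply: half_le.
rewrite addrC -lev_subr_addr; apply: modulus_le.
  by rewrite lev_subr_addr addrC xE lev_D ?le_vjoinl.
by rewrite lev_subr_addr addrC yE lev_D ?le_vjoinr.
Qed.

Lemma vmeet_ler x y : vmeet x y <= y.
Proof. by have := lexx (vmeet x y); rewrite le_vmeet => /andP[]. Qed.

Lemma vmeet_vjoin x y : vmeet x y = - vjoin (- x) (- y).
Proof.
apply/le_anti/andP; split.
  by rewrite -[leLHS]opprK lev_N// vjoin_le !lev_N ?vmeet_lel ?vmeet_ler.
by rewrite le_vmeet; apply/andP; split; apply: lev_Nl;
  rewrite ?le_vjoinl ?le_vjoinr.
Qed.

(** Joins are linear combinations of [x], [y] and a modulus by [vjoin_modulus], and meets are joins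
    up to signs. *)
Lemma modulus_closed_sublattice (S : submodClosed V) :
  {in S, forall x, modulus x \in S} -> is_sublattice S.
Proof.
move=> Smod; have SN : {in S, forall x, - x \in S}.
  by move=> x Sx; rewrite -scaleN1r rpredZ.
have Sjoin : {in S &, forall x y, vjoin x y \in S}.
  move=> x y Sx Sy; rewrite vjoin_modulus.
  by apply/rpredZ/rpredD; [|apply: Smod]; apply: rpredD => //; exact: SN.
split; first by split=> [|a x y Sx Sy]; rewrite ?rpred0 ?rpredD ?rpredZ.
by move=> x y Sx Sy; rewrite vmeet_vjoin SN !Sjoin ?SN.
Qed.

End VectorLattice.

Section MartingaleModulus.
Variables (R : realType) (X : normedLatticeType R) (E : nat -> {linear X -> X}).

Lemma bounded_seq_update (x : nat -> X) k y :
  bounded_seq x -> bounded_seq (fun n => if n == k then y else x n).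
Proof.
move=> [M xM]; exists (Num.max (lnorm y) M) => n.
by rewrite le_max; case: ifP => _; rewrite ?lexx ?xM ?orbT.
Qed.

Lemma E_martingale_update (x : nat -> X) k y :
  E_martingale E x -> E_martingale E (fun n => if n == k then y else x n).
Proof.
(* Starting from [k.+1] keeps both indices [n] and [m] strictly beyond the altered term. *)
move=> [l xl]; exists (maxn l k.+1) => n m; rewrite geq_max => /andP[ln kn] nm.
by rewrite !gtn_eqF ?(leq_trans kn)// xl.
Qed.

Lemma ME_update (B : ME E) k y :
  exists C : ME E, forall n, C n = if n == k then y else B n.
Proof.
have Cbd := bounded_seq_update k y (elimT (linf_predP _) (valP (ME_val B))).
have Cmart := E_martingale_update k y (elimT (ME_predP E _) (valP B)).
pose C := Linf (introT (linf_predP _) Cbd).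
by exists (MEmk (introT (ME_predP E C) Cmart)).
Qed.

(** Upper bounds of [A] and [- A] are tested coordinatewise, and there they are the bounds of the
    modulus taken in [X]. Minimality still ranges over martingales only. *)
Lemma is_modulusP (A B : ME E) :
  is_modulus A B <->
  (forall n, modulus (A n) <= B n) /\
  (forall C : ME E, (forall n, modulus (A n) <= C n) -> B <= C).
Proof.
have ubP (C : ME E) : ubound [set A; - A] C <-> forall n, modulus (A n) <= C n.
  split=> [ubC n|AC D].
    have /le_MEP AC := ubC A (or_introl erefl).
    have /le_MEP NAC := ubC (- A) (or_intror erefl).
    exact: modulus_le (AC n) (NAC n).
  by case=> ->; apply/le_MEP => n; apply: le_trans (AC n);
    [exact: le_modulus|exact: leN_modulus].
split=> [[/ubP AB minB]|[/ubP AB minB]].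
  by split=> // C /ubP; exact: minB.
by split=> // C /ubP; exact: minB.
Qed.

Lemma is_modulus_coord (A B : ME E) :
  is_modulus A B -> forall k, B k = modulus (A k).
Proof.
move=> /is_modulusP[AB minB] k; apply/le_anti; rewrite AB andbT.
have [C CE] := ME_update B k (modulus (A k)).
have /minB/le_MEP/(_ k) : forall n, modulus (A n) <= C n.
  by move=> n; rewrite CE; case: eqP => [->|_].
by rewrite CE eqxx.
Qed.

Lemma sublattice_is_vector_lattice :
  is_sublattice (ME_pred E) -> is_vector_lattice (ME E).
Proof.
move=> [_ ME_lat] A B; have [joinAB meetAB] := ME_lat _ _ (valP A) (valP B).
split; [exists (MEmk joinAB)|exists (MEmk meetAB)]; split.
- by move=> D [->|->]; [exact: le_vjoinl|exact: le_vjoinr].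
(* The order of [ME E] is induced from [linf X], so the join computed there remains least among
   martingales. *)
- move=> D ubD; rewrite leEsub/= vjoin_le.
  by apply/andP; split; apply: ubD; [left|right].
- by move=> D [->|->]; [exact: vmeet_lel|exact: vmeet_ler].
- move=> D lbD; rewrite leEsub/= le_vmeet.
  by apply/andP; split; apply: lbD; [left|right].
Qed.

End MartingaleModulus.

Theorem theorem6 (R : realType) (X : normedLatticeType R)
    (E : nat -> {linear X -> X}) (hE : contractive_filtration E) :
  [<-> is_vector_lattice (ME E);
       forall A : ME E,
         E_martingale E (fun n => modulus (A n)) /\
         exists2 B : ME E, is_modulus A B & forall n, B n = modulus (A n);
       is_sublattice (ME_pred E)].
Proof.
tfae.
(* The supremum of [A] and [- A] is by definition a modulus of [A] in [ME E]. *)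
- move=> ME_lat A; have [[B AB] _] := ME_lat A (- A).
  have BE := is_modulus_coord AB; split; last by exists B.
  by rewrite -(funext BE); exact: (elimT (ME_predP E _) (valP B)).
- move=> ME_mod; apply: modulus_closed_sublattice => A AE.
  (* The modulus of [linf X] is computed coordinatewise, so its membership in [ME_pred E] is the
     martingale clause of (ii). *)
  by apply/ME_predP; have [] := ME_mod (MEmk AE).
- exact: sublattice_is_vector_lattice.
Qed.
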